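(* There exists a family $(H_n)_{n\in\mathbb{N}_{\ge 1}}$ of connected graphs, where $H_n$ has $n$ nodes, such that $\mathrm{MS}(H_n,K_n)\in\Omega(n^2)$ and $\mathrm{MT}(H_n,K_n)\in\Omega(n)$, where $K_n$ is the complete graph on $n$ nodes.
   Context: Graphs are finite, simple and undirected. An instance of the Token Meeting Problem (TMP) is a pair $(H,A)$ of graphs $H=(V,E)$ (nodes $V$, edges $E$) and $A=(Q,C)$ (tokens $Q$, connections $C$) with $|V|=|Q|$. A solution $(f_1,\mathcal{S})$ consists of a bijection $f_1:Q\to V$ and a finite sequence $\mathcal{S}=(M_1,\dots,M_k)$, $k\ge 0$, of (possibly empty) matchings $M_i\subseteq E$ such that for each $\{p,q\}\in C$ there is $t\in\{1,\dots,k+1\}$ with $\{f_t(p),f_t(q)\}\in E$, where for $t>1$, $f_t:=\pi_{M_{t-1}}\circ f_{t-1}$ and $\pi_M:V\to V$ is the product of the transpositions $\tau_{uv}$ over all $\{u,v\}\in M$. The number of steps of the solution is $k$ and its number of swaps is $\sum_{t=1}^k|M_t|$. $\mathrm{MS}(H,A)$ is the minimum number of swaps of any solution and $\mathrm{MT}(H,A)$ is the minimum number of steps of any solution. $g(n)\in\Omega(h(n))$ means that there are $c>0$ and $n_0$ with $g(n)\ge c\,h(n)$ for all $n\ge n_0$. *)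

(* Defs.v *)
From HB Require Import structures.
From mathcomp Require Import all_boot all_fingroup.
From mathcomp Require Import boolp.

Set Implicit Arguments.
Unset Strict Implicit.
Unset Printing Implicit Defensive.

Record sgraph := SGraph {
  node :> finType;
  adj : rel node;
  adj_sym : symmetric adj;
  adj_irrefl : irreflexive adj }.

Definition edges (G : sgraph) : {set {set G}} :=
  [set [set p.1; p.2] | p in [pred p : G * G | adj p.1 p.2]].

Definition graph_connected (G : sgraph) : Prop :=
  forall x y : G, connect (@adj G) x y.

Section Complete.
Variable n : nat.
Let neq : rel 'I_n := fun i j => i != j.
Fact neq_sym : symmetric neq.
Proof. by move=> i j; rewrite /neq eq_sym. Qed.
Fact neq_irrefl : irreflexive neq.
Proof. by move=> i; rewrite /neq eqxx. Qed.
Definition complete : sgraph := SGraph neq_sym neq_irrefl.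
End Complete.

Definition matching (G : sgraph) (M : {set {set G}}) : bool :=
  (M \subset edges G) && trivIset M.

(* The transposition of a two-element set; only used on edges. *)
Definition edge_swap (V : finType) (e : {set V}) : {perm V} :=
  if enum e is [:: u; v] then tperm u v else 1%g.

(* For a matching the factors commute, so their order is irrelevant. *)
Definition matching_perm (V : finType) (M : {set {set V}}) : {perm V} :=
  (\prod_(e in M) edge_swap e)%g.

(* Indices start at 0: for S = (M_1, ..., M_k), [nth set0 S t] is M_(t+1) and
   [placement f1 S t] is f_(t+1), the position of the tokens after t steps. *)
Fixpoint placement (Q V : finType) (f1 : Q -> V) (S : seq {set {set V}})
    (t : nat) : Q -> V :=
  if t is t'.+1
  then matching_perm (nth set0 S t') \o placement f1 S t'
  else f1.

(* H is the graph of nodes, A the graph of tokens and their connections.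
   The bijection forces H and A to have equally many vertices. *)
Definition is_solution (H A : sgraph) (f1 : A -> H) (S : seq {set {set H}})
    : Prop :=
  [/\ bijective f1,
      all (@matching H) S
    & forall p q : A, adj p q ->
        exists2 t : nat, (t <= size S)%N &
          adj (placement f1 S t p) (placement f1 S t q)].

Definition num_steps (V : finType) (S : seq {set {set V}}) : nat := size S.

Definition num_swaps (V : finType) (S : seq {set {set V}}) : nat :=
  (\sum_(M <- S) #|M|)%N.

(* The minimum of a set of naturals, with value 0 on the empty set. *)
Definition least (P : nat -> Prop) : nat :=
  if pselect (exists n, `[< P n >]) is left exP then ex_minn exP else 0%N.

(* Both are 0 when there is no solution; this convention can only make a
   lower bound on them harder to satisfy. *)
Definition MS (H A : sgraph) : nat :=
  least (fun s => exists (f1 : A -> H) (S : seq {set {set H}}),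
    is_solution f1 S /\ num_swaps S = s).

Definition MT (H A : sgraph) : nat :=
  least (fun k => exists (f1 : A -> H) (S : seq {set {set H}}),
    is_solution f1 S /\ num_steps S = k).

(* Main.v *)
Require Import Defs.
From mathcomp Require Import all_boot all_fingroup all_order all_algebra.
From mathcomp Require Import zify.

(** The witnesses are the paths.  Call an arc an ordered pair of adjacent
    vertices.  Two tokens have met exactly when some placement sends their
    pair to an arc of [H], and a placement is injective, so in a graph of
    maximum degree [d] it realizes at most [#|H| * d] pairs.

    For the number of steps, a solution with [k] steps shows [k + 1]
    placements, hence at most [#|H| * d * (k + 1)] pairs meet
    ([solution_steps_bound]).  For the number of swaps, a pair that meets just
    after a matching [M] was applied, and not just before, must have moved, so
    its arc touches one of the at most [2 * #|M|] vertices covered by [M];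
    there are at most [4 * d * #|M|] such arcs ([card_newly_met]).  Summing
    over the steps, at most [#|H| * d + 4 * d * s] pairs meet with [s] swaps
    ([solution_swaps_bound]).

    Since all [n * (n - 1)] ordered pairs of tokens of the complete graph have
    to meet and [d = 2] for a path, [s] is quadratic and [k] is linear in [n].

    The minimum over an empty set of solutions being 0, the bounds also require
    that a solution exists.  This holds for every connected graph
    ([solution_exists]): any token can be walked along a path until it is next
    to any other one, and this is done for each pair of tokens in turn. *)

(** * Swaps along matchings *)

Lemma edge_swap_out (V : finType) (e : {set V}) x : x \notin e -> edge_swap e x = x.
Proof.
rewrite /edge_swap -mem_enum; case: (enum e) => [|u [|v [|w s]]]; rewrite ?perm1 //.
by rewrite !inE negb_or => /andP[xu xv]; rewrite tpermD // eq_sym.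
Qed.

Lemma edge_swap_set2 (V : finType) (x y : V) : x != y -> edge_swap [set x; y] x = y.
Proof.
move=> xy; have : size (enum [set x; y]) = 2 by rewrite -cardE cards2 xy.
have : x \in enum [set x; y] by rewrite mem_enum set21.
have : y \in enum [set x; y] by rewrite mem_enum set22.
rewrite /edge_swap; case: (enum _) => [|u [|v []]] //; rewrite !inE.
move=> /orP[] /eqP ey /orP[] /eqP ex _; move: xy; rewrite ex ey ?eqxx // => _.
  exact: tpermR.
exact: tpermL.
Qed.

Lemma edge_swap_set2_out (V : finType) (x y z : V) :
  z != x -> z != y -> edge_swap [set x; y] z = z.
Proof. by move=> zx zy; apply: edge_swap_out; rewrite !inE negb_or zx. Qed.

Lemma matching_perm_out (V : finType) (M : {set {set V}}) x :
  x \notin cover M -> matching_perm M x = x.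
Proof.
move=> xM; rewrite /matching_perm.
elim/big_ind: _ => [|s1 s2 e1 e2|e eM]; rewrite ?perm1 ?permM ?e1 ?e2 //.
by apply: edge_swap_out; apply: contra xM => xe; apply/bigcupP; exists e.
Qed.

(** [matching_perm M] permutes [cover M], so a vertex whose image is uncovered
    is itself uncovered, hence fixed. *)
Lemma matching_perm_notin_cover (V : finType) (M : {set {set V}}) x :
  matching_perm M x \notin cover M -> matching_perm M x = x.
Proof. by move=> /matching_perm_out /perm_inj. Qed.

Lemma card_cover_matching (G : sgraph) (M : {set {set G}}) :
  matching M -> #|cover M| <= 2 * #|M|.
Proof.
move=> /andP[/subsetP sME _]; apply: leq_trans (leq_card_cover M) _.
rewrite mulnC -sum_nat_const; apply: leq_sum => e /sME /imsetP[a _ ->].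
by rewrite cards2; case: (_ != _).
Qed.

Lemma matching_edge (G : sgraph) (x y : G) : adj x y -> matching (G:=G) [set [set x; y]].
Proof.
move=> xy; rewrite /matching sub1set; apply/andP; split.
  by apply/imsetP; exists (x, y).
by apply/trivIsetP => B C /set1P-> /set1P->; rewrite eqxx.
Qed.

(** * Arcs of graphs of bounded degree *)

Definition degree_leq (G : sgraph) (d : nat) : Prop :=
  forall x : G, #|[set y | adj x y]| <= d.

Definition arcs_from (G : sgraph) (X : {set G}) : {set G * G} :=
  [set a | (a.1 \in X) && adj a.1 a.2].

Lemma card_arcs_from {G : sgraph} (X : {set G}) d :
  degree_leq G d -> #|arcs_from G X| <= #|X| * d.
Proof.
move=> deg; rewrite -sum1dep_card.
rewrite -(pair_big_dep (mem X) (@adj G) (fun _ _ => 1)) /=.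
rewrite -sum_nat_const; apply: leq_sum => x _.
by rewrite sum1dep_card; exact: deg.
Qed.

Lemma card_preimset_leq (aT rT : finType) (g : aT -> rT) (B : {set rT}) :
  injective g -> #|g @^-1: B| <= #|B|.
Proof.
move=> g_inj; rewrite -(card_imset _ g_inj); apply: subset_leq_card.
by apply/subsetP => _ /imsetP[x + ->]; rewrite inE.
Qed.

Lemma pair_map_inj (aT rT : Type) (f : aT -> rT) :
  injective f -> injective (fun a : aT * aT => (f a.1, f a.2)).
Proof. by move=> f_inj [a b] [c d] [/f_inj -> /f_inj ->]. Qed.

(** * Counting meetings *)

Section Counting.
Context {H A : sgraph}.
Implicit Types (f : A -> H) (M : {set {set H}}) (S : seq {set {set H}}).

Lemma placement_inj f S t : injective f -> injective (placement f S t).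
Proof. by move=> f_inj; elim: t => //= t IH; apply: inj_comp => //; exact: perm_inj. Qed.

Definition met f : {set A * A} := [set a | adj (f a.1) (f a.2)].

Lemma card_met f d : degree_leq H d -> injective f -> #|met f| <= #|H| * d.
Proof.
move=> deg f_inj; rewrite -cardsT.
apply: leq_trans (card_arcs_from _ _ deg).
apply: leq_trans (card_preimset_leq _ _ _ _ (pair_map_inj _ _ _ f_inj)).
by apply: subset_leq_card; apply/subsetP => a; rewrite !inE.
Qed.

(** Both endpoints of a pair that is adjacent after [M] but not before cannot be
    fixed by [M], so the new arc, or its reversal, starts in [cover M]. *)
Lemma card_newly_met f M d : degree_leq H d -> injective f -> matching M ->
  #|met (matching_perm M \o f) :\: met f| <= 4 * d * #|M|.
Proof.
move=> deg f_inj matM; set f' := _ \o f.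
have f'_inj : injective f' by apply: inj_comp => //; exact: perm_inj.
set C := arcs_from H (cover M).
pose sw (a : A * A) := (f' a.2, f' a.1).
have sub : met f' :\: met f \subset
   ((fun a : A * A => (f' a.1, f' a.2)) @^-1: C) :|: (sw @^-1: C).
  apply/subsetP => -[p q]; rewrite !inE /= => /andP[nadj adj'].
  rewrite [adj (f' q) _]adj_sym adj' !andbT.
  case: (boolP (f' p \in _)) => //= /matching_perm_notin_cover fp.
  apply: contraR nadj => /matching_perm_notin_cover fq.
  by rewrite -fp -fq.
apply: leq_trans (subset_leq_card sub) _.
apply: leq_trans (leq_card_setU _ _) _.
have cC : #|C| <= 2 * #|M| * d.
  by apply: leq_trans (card_arcs_from _ _ deg) _; rewrite leq_mul2r card_cover_matching ?orbT.
have sw_inj : injective sw by move=> [a b] [c e] [/f'_inj -> /f'_inj ->].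
have -> : 4 * d * #|M| = 2 * #|M| * d + 2 * #|M| * d by lia.
apply: leq_add; apply: leq_trans cC; apply: card_preimset_leq => //.
exact: pair_map_inj.
Qed.

(** Charging each pair to the first time at which it is adjacent. *)
Lemma card_met_upto (F : nat -> A -> H) k :
  #|\bigcup_(t < k.+1) met (F t)|
    <= #|met (F 0)| + \sum_(t < k) #|met (F t.+1) :\: met (F t)|.
Proof.
elim: k => [|k IH]; first by rewrite big_ord_recl !big_ord0 setU0 addn0.
rewrite big_ord_recr /= [in leqRHS]big_ord_recr /= addnA.
apply: leq_trans (leq_add IH (leqnn _)).
set U := \bigcup_(t < k.+1) _; apply: leq_trans (leq_card_setU _ _).
apply: subset_leq_card; rewrite subUset subsetUl /=.
apply/subsetP => a aF; rewrite !inE in aF *; rewrite aF andbT.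
case: (boolP (adj (F k a.1) (F k a.2))) => [aFk|//]; last by rewrite orbT.
by rewrite orbF; apply/bigcupP; exists ord_max; rewrite ?inE.
Qed.

Lemma solution_card_leq f S : is_solution f S ->
  #|arcs_from A [set: A]| <=
    #|met f| + \sum_(t < size S) #|met (placement f S t.+1) :\: met (placement f S t)|.
Proof.
move=> [_ _ meet]; apply: leq_trans (card_met_upto (placement f S) _).
apply: subset_leq_card; apply/subsetP => a; rewrite !inE /= => /meet[t tS adjt].
by apply/bigcupP; exists (Ordinal (tS : t < (size S).+1)); rewrite ?inE.
Qed.

Lemma solution_steps_bound f S d : degree_leq H d ->
  is_solution f S -> #|arcs_from A [set: A]| <= #|H| * d * (num_steps S).+1.
Proof.
move=> deg sol; have [/bij_inj f_inj _ _] := sol.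
apply: leq_trans (solution_card_leq _ _ sol) _; rewrite mulnS.
apply: leq_add; first exact: card_met.
rewrite mulnC -{1}(card_ord (num_steps S)) -sum_nat_const; apply: leq_sum => t _.
apply: leq_trans (subset_leq_card (subsetDl _ _)) _.
by apply: card_met => //; apply: placement_inj.
Qed.

Lemma solution_swaps_bound f S d : degree_leq H d ->
  is_solution f S ->
  #|arcs_from A [set: A]| <= #|H| * d + 4 * d * num_swaps S.
Proof.
move=> deg sol; have [/bij_inj f_inj /all_nthP matS _] := sol.
apply: leq_trans (solution_card_leq _ _ sol) _.
apply: leq_add; first exact: card_met.
rewrite /num_swaps (big_nth set0) big_mkord big_distrr /=; apply: leq_sum => t _.
by apply: card_newly_met => //; [exact: placement_inj | exact: matS].
Qed.

End Counting.

(** * Existence of solutions *)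

Section Existence.
Context {H A : sgraph}.
Implicit Types (f : A -> H) (S : seq {set {set H}}).

Lemma placement_catl f S1 S2 t : t <= size S1 ->
  placement f (S1 ++ S2) t = placement f S1 t.
Proof. by elim: t => //= t IH tS; rewrite nth_cat tS IH // ltnW. Qed.

Lemma placement_catr f S1 S2 t :
  placement f (S1 ++ S2) (size S1 + t) =
  placement (placement f S1 (size S1)) S2 t.
Proof.
elim: t => [|t IH]; first by rewrite addn0 placement_catl.
by rewrite addnS /= IH nth_cat ltnNge leq_addr /= addKn.
Qed.

(** Swapping [p] along the edges of a path towards [q] leaves [q] in place until
    the next vertex on the path is the position of [q], and then they meet. *)
Lemma bring_together f p q : graph_connected H -> injective f -> p != q ->
  exists2 S, all (@matching H) S &
    adj (placement f S (size S) p) (placement f S (size S) q).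
Proof.
move=> conn + pq; have /connectP[s] := conn (f p) (f q).
elim: s f => [|y s IH] f /=; first by move=> _ e /(_ _ _ e) /eqP; rewrite eq_sym (negbTE pq).
move=> /andP[xy ys] lastq f_inj.
have [yq|yq] := eqVneq y (f q); first by exists [::] => //=; rewrite -yq.
have xy_neq : f p != y by apply: contraTneq xy => ->; rewrite adj_irrefl.
pose M := [set [set f p; y]]; pose f' := matching_perm M \o f.
have f'p : f' p = y by rewrite /f' /= /matching_perm big_set1 edge_swap_set2.
have f'q : f' q = f q.
  rewrite /f' /= /matching_perm big_set1 edge_swap_set2_out 1?eq_sym //.
  by rewrite (inj_eq f_inj).
have [|||S matS adjS] := IH f'.
- by rewrite f'p.
- by rewrite f'p f'q.
- exact: (placement_inj f [:: M] 1).
exists (M :: S); first by rewrite /= matching_edge.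
by rewrite -[size _]/(size [:: M] + size S) (placement_catr f [:: M]).
Qed.

(** The sequences provided by [bring_together] are concatenated over all pairs,
    each one starting from the placement that the previous ones produce. *)
Lemma solution_exists f : graph_connected H -> bijective f ->
  exists S, is_solution f S.
Proof.
move=> conn f_bij.
(* The initial placement has to vary, as the tokens keep moving. *)
suff main : forall (ps : seq (A * A)) (g : A -> H), injective g ->
  exists2 S, all (@matching H) S & forall a, a \in ps -> a.1 != a.2 ->
    exists2 t, t <= size S &
      adj (placement g S t a.1) (placement g S t a.2).
  have [S matS meet] := main (enum {: A * A}) f (bij_inj f_bij).
  exists S; split=> // p q pq; apply: (meet (p, q)); first by rewrite mem_enum.
  by apply: contraTneq pq => /= ->; rewrite adj_irrefl.
elim=> [|[p q] ps IH] g g_inj; first by exists [::].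
have [S1 mat1 meet1] : exists2 S1, all (@matching H) S1 & p != q ->
    adj (placement g S1 (size S1) p) (placement g S1 (size S1) q).
  have [->|pq] := eqVneq p q; first by exists [::].
  by have [S1] := bring_together g p q conn g_inj pq; exists S1.
have [S2 mat2 meet2] := IH _ (placement_inj g S1 (size S1) g_inj).
exists (S1 ++ S2); first by rewrite all_cat mat1.
move=> a; rewrite inE size_cat => /orP[/eqP -> /= pq|ain aneq].
  by exists (size S1); rewrite ?leq_addr // placement_catl ?meet1.
have [t tS adjt] := meet2 a ain aneq.
by exists (size S1 + t); rewrite ?leq_add2l // placement_catr.
Qed.

End Existence.

(** * Paths *)

Lemma least_mem (P : nat -> Prop) : (exists n, P n) -> P (least P).
Proof.
move=> [n Pn]; rewrite /least; case: boolp.pselect => [exP|[]].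
  by case: ex_minnP => m /boolp.asboolP.
by exists n; apply/boolp.asboolP.
Qed.

Lemma card_arcs_complete n : #|arcs_from (complete n) [set: 'I_n]| = n * n.-1.
Proof.
rewrite -sum1dep_card -(pair_big_dep (mem [set: 'I_n]) (@adj (complete n)) (fun _ _ => 1)) /=.
rewrite (eq_bigr (fun _ => n.-1)) => [|x _].
  by rewrite sum_nat_const cardsT card_ord.
rewrite sum1dep_card -[in RHS](card_ord n) -(cardC1 x) -cardsE.
by apply: eq_card => y; rewrite !inE eq_sym.
Qed.

Definition path_adj n : rel 'I_n := fun i j => (i.+1 == j) || (j.+1 == i).

Lemma path_adj_sym n : symmetric (path_adj n).
Proof. by move=> i j; rewrite /path_adj orbC. Qed.

Lemma path_adj_irrefl n : irreflexive (path_adj n).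
Proof. by move=> i; rewrite /path_adj; lia. Qed.

Definition path_graph n : sgraph := SGraph (path_adj_sym n) (path_adj_irrefl n).

Lemma path_graph_connected n : graph_connected (path_graph n).
Proof.
have from0 i (ltin : i < n) (lt0n : 0 < n) :
    connect (@adj (path_graph n)) (Ordinal lt0n) (Ordinal ltin).
  elim: i ltin => [|i IH] ltin; first by rewrite (bool_irrelevance ltin lt0n).
  apply: connect_trans (IH (ltnW ltin)) (connect1 _).
  by rewrite /= /path_adj /= eqxx.
have csym : connect_sym (@adj (path_graph n)) by apply: sym_connect_sym; apply: adj_sym.
move=> [i ltin] [j ltjn]; have lt0n : 0 < n by apply: leq_ltn_trans ltin.
by apply: connect_trans (from0 j ltjn lt0n); rewrite csym.
Qed.

Lemma path_graph_degree n : degree_leq (path_graph n) 2.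
Proof.
move=> x; rewrite cardE -(size_map val); apply: (@uniq_leq_size _ _ [:: x.+1; x.-1]).
  by rewrite map_inj_uniq ?enum_uniq //; exact: val_inj.
move=> _ /mapP[y + ->]; rewrite mem_enum inE /= /path_adj !inE; lia.
Qed.

Lemma identity_solution_exists n :
  exists S, @is_solution (path_graph n) (complete n) id S.
Proof.
exact: solution_exists (@path_graph_connected n) (Bijective (fun _ => erefl) (fun _ => erefl)).
Qed.

Lemma path_MS_bound n : n * n.-1 <= n * 2 + 8 * MS (path_graph n) (complete n).
Proof.
have [S0 sol0] := identity_solution_exists n.
have /least_mem [f [S [sol swapsS]]] :
    exists s, exists (f : complete n -> path_graph n) S,
      is_solution f S /\ num_swaps S = s by exists (num_swaps S0), id, S0.
have := solution_swaps_bound f S 2 (path_graph_degree n) sol.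
by rewrite card_arcs_complete card_ord swapsS.
Qed.

Lemma path_MT_bound n :
  n * n.-1 <= n * 2 * (MT (path_graph n) (complete n)).+1.
Proof.
have [S0 sol0] := identity_solution_exists n.
have /least_mem [f [S [sol stepsS]]] :
    exists k, exists (f : complete n -> path_graph n) S,
      is_solution f S /\ num_steps S = k by exists (num_steps S0), id, S0.
have := solution_steps_bound f S 2 (path_graph_degree n) sol.
by rewrite card_arcs_complete card_ord stepsS.
Qed.

(** * Asymptotics *)

From mathcomp Require Import boolp classical_sets reals topology normedtype landau.
Import Order.TTheory GRing.Theory Num.Theory.
Import numFieldNormedType.Exports.
Local Open Scope classical_set_scope.
Local Open Scope ring_scope.

Lemma natr_bigOmega (R : realType) (u v : nat -> nat) (c N : nat) :
  (forall n, N <= n -> v n <= c * u n)%N ->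
  (fun n => (u n)%:R : R) \is 'Omega_\oo (fun n => (v n)%:R : R).
Proof.
move=> vu; rewrite qualifE; apply/asboolP.
(* The successor keeps the constant positive when [c] is 0. *)
exists (c.+1%:R^-1); first by rewrite invr_gt0 ltr0n.
near=> n; rewrite !ger0_norm ?ler0n // ler_pdivrMl ?ltr0n // -natrM ler_nat.
have Nn : (N <= n)%N by near: n; exact: nbhs_infty_ge.
by apply: leq_trans (vu n Nn) _; rewrite leq_mul2r leqnSn orbT.
Unshelve. all: by end_near. Qed.

Theorem theorem3p9 (R : realType) :
  exists H : nat -> sgraph,
    [/\ forall n : nat, (1 <= n)%N -> #|H n| = n /\ graph_connected (H n),
        (fun n : nat => (MS (H n) (complete n))%:R : R)
          \is 'Omega_\oo (fun n : nat => n%:R ^+ 2 : R)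
      & (fun n : nat => (MT (H n) (complete n))%:R : R)
          \is 'Omega_\oo (fun n : nat => n%:R : R)].
Proof.
exists path_graph; split.
- by move=> n _; split; [exact: card_ord | exact: path_graph_connected].
- under [X in 'Omega_\oo X]funext do rewrite -natrX.
  (* [path_MS_bound] gives [n * (n - 3) <= 8 * MS], and [n <= 2 * (n - 3)] as
     soon as [6 <= n]. *)
  apply: (@natr_bigOmega R _ (fun n => n ^ 2)%N 16 6) => n n6.
  by have := path_MS_bound n; nia.
- (* [path_MT_bound] gives [n - 3 <= 2 * MT], with the same threshold. *)
  apply: (@natr_bigOmega R _ id 4 6) => n n6.
  by have := path_MT_bound n; nia.
Qed.
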